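(* Let $p\ge1$, $n:=\lfloor p\rfloor$, let $V,U$ be Banach spaces, let $X:[0,T]\to V$ satisfy $\|X\|_{p\text{-var};[0,T]}<\infty$ (no continuity assumed), and let $F\in\mathcal C^{n+1}_b(V,U)$. Then: (1) The limit $$\int_0^TDF(X_t)\,d\mathbb X_t:=\mathrm{RRS}\text{-}\lim_\Pi\sum_{[t_i,t_{i+1}]\in\Pi}\sum_{k=1}^n\frac1{k!}D^kF(X_{t_i})(X_{t_{i+1}}-X_{t_i})^{\otimes k}$$ exists, the series below converge absolutely (they have at most countably many nonzero terms), and $$F(X_T)-F(X_0)=\int_0^TDF(X_t)\,d\mathbb X_t+\sum_{0<t\le T}\Big(F(X_t)-F(X_{t-})-\sum_{k=1}^n\frac1{k!}D^kF(X_{t-})(\Delta^-_tX)^{\otimes k}\Big)+\sum_{0\le t<T}\Big(F(X_{t+})-F(X_t)-\sum_{k=1}^n\frac1{k!}D^kF(X_t)(\Delta^+_tX)^{\otimes k}\Big).$$ (2) If $X$ is càdlàg (right-continuous with left limits), then $$F(X_T)-F(X_0)=\int_0^TDF(X_t)\,d\mathbb X_t+\sum_{0<t\le T}\Big(F(X_t)-F(X_{t-})-\sum_{k=1}^n\frac1{k!}D^kF(X_{t-})(\Delta^-_tX)^{\otimes k}\Big).$$ (3) If $X$ is continuous, then $F(X_T)-F(X_0)=\int_0^TDF(X_t)\,d\mathbb X_t$.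
   Context: Tensor powers carry norms with $\|a\otimes b\|=\|a\|\|b\|$ (e.g. $V$ finite-dimensional). $\|X\|_{p\text{-var};[0,T]}:=(\sup_\Pi\sum_{[t_i,t_{i+1}]\in\Pi}\|X_{t_{i+1}}-X_{t_i}\|^p)^{1/p}$ over partitions $\Pi=\{0=t_0<\dots<t_N=T\}$ of $[0,T]$. A path of finite $p$-variation has left and right limits everywhere; $X_{t-}:=\lim_{u\uparrow t}X_u$, $X_{t+}:=\lim_{u\downarrow t}X_u$, $\Delta^-_tX:=X_t-X_{t-}$, $\Delta^+_tX:=X_{t+}-X_t$. $\mathcal C^k_b(V,U)$ is the set of $k$ times continuously differentiable $F:V\to U$ with $\|D^jF\|_\infty<\infty$ for $j=0,\dots,k$, where $D^jF(x)$ is a bounded symmetric $j$-linear map applied to $h^{\otimes j}$. RRS convergence: sums $S(\Pi)$ converge to $K$ in the refinement Riemann–Stieltjes sense if for every $\varepsilon>0$ there is a partition $\Pi_\varepsilon$ such that $\|S(\Pi)-K\|<\varepsilon$ for every partition $\Pi\supset\Pi_\varepsilon$. *)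

(* Defs.v *)
From HB Require Import structures.
From mathcomp Require Import all_boot all_order all_algebra all_fingroup.
From mathcomp Require Import all_classical all_reals all_analysis.
Set Implicit Arguments. Unset Strict Implicit. Unset Printing Implicit Defensive.
Import Order.TTheory GRing.Theory Num.Theory.
Import numFieldNormedType.Exports.
Local Open Scope classical_set_scope.
Local Open Scope ring_scope.

Section Defs.
Variables (R : realType) (V U : completeNormedModType R).

(** Partitions {0 = t_0 < t_1 < ... < t_N = T} of [0,T] are encoded by the
    list s = [:: t_1; ...; t_N] (0 is implicit). *)
Definition is_partition (T : R) (s : seq R) : bool :=
  path <%R 0 s && (last 0 s == T).

Definition psum (W : nmodType) (s : seq R) (f : R -> R -> W) : W :=
  \sum_(st <- zip (0 :: s) s) f st.1 st.2.

Definition finite_pvar (p T : R) (X : R -> V) : Prop :=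
  exists M : R, forall s, is_partition T s ->
    psum s (fun a b => `|X b - X a| `^ p) <= M.

Definition RRS_cvg (T : R) (S : seq R -> U) (K : U) : Prop :=
  forall e : R, 0 < e -> exists se, is_partition T se /\
    forall s, is_partition T s -> {subset se <= s} -> `|S s - K| < e.

Definition ffset (k : nat) (h : {ffun 'I_k -> V}) (i : 'I_k) (v : V) :
  {ffun 'I_k -> V} := [ffun j => if j == i then v else h j].

Definition multilinear (k : nat) (L : {ffun 'I_k -> V} -> U) : Prop :=
  forall (h : {ffun 'I_k -> V}) (i : 'I_k) (a : R) (v w : V),
    L (ffset h i (a *: v + w)) = a *: L (ffset h i v) + L (ffset h i w).

Definition symmetric_ml (k : nat) (L : {ffun 'I_k -> V} -> U) : Prop :=
  forall (h : {ffun 'I_k -> V}) (s : 'S_k), L [ffun j => h (s j)] = L h.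

Definition ffnorm (k : nat) (h : {ffun 'I_k -> V}) : R := \prod_(i < k) `|h i|.

Definition ffcons (k : nat) (v : V) (h : {ffun 'I_k -> V}) : {ffun 'I_k.+1 -> V} :=
  [ffun j => if unlift ord0 j is Some j' then h j' else v].

(** F is in C^m_b(V,U) with derivatives D 0 = F, D 1 = DF, ..., D m = D^m F:
    each D j x is a bounded symmetric j-linear map, D j is Frechet
    differentiable (in operator norm) with derivative D (j+1) for j < m,
    D m is continuous in operator norm, and sup_x ||D j x|| < oo for j <= m. *)
Definition Cb (m : nat) (F : V -> U)
    (D : forall k : nat, V -> {ffun 'I_k -> V} -> U) : Prop :=
  [/\ (forall x h, D 0%N x h = F x),
      (forall j x, (j <= m)%N -> multilinear (D j x) /\ symmetric_ml (D j x)),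
      (forall j, (j < m)%N -> forall x (e : R), 0 < e -> exists2 d : R, 0 < d &
         forall y, `|y - x| < d -> forall h : {ffun 'I_j -> V},
           `|D j y h - D j x h - D j.+1 x (ffcons (y - x) h)|
             <= e * `|y - x| * ffnorm h),
      (forall x (e : R), 0 < e -> exists2 d : R, 0 < d &
         forall y, `|y - x| < d -> forall h : {ffun 'I_m -> V},
           `|D m y h - D m x h| <= e * ffnorm h) &
      (forall j, (j <= m)%N -> exists C : R, forall x h,
         `|D j x h| <= C * ffnorm h)].

Definition taylor (D : forall k : nat, V -> {ffun 'I_k -> V} -> U)
    (n : nat) (x h : V) : U :=
  \sum_(1 <= k < n.+1) (k`!%:R)^-1 *: D k x [ffun _ : 'I_k => h].

Definition abs_sum (A : set R) (J : R -> U) (S : U) : Prop :=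
  [/\ countable [set t | A t /\ J t != 0],
      (exists M : R, forall s : seq R, uniq s -> {subset s <= A} ->
         \sum_(t <- s) `|J t| <= M) &
      (forall e : R, 0 < e -> exists s0 : seq R, uniq s0 /\ {subset s0 <= A} /\
         forall s : seq R, uniq s -> {subset s <= A} -> {subset s0 <= s} ->
           `|\sum_(t <- s) J t - S| < e)].

Definition lft (X : R -> V) (t : R) : V := lim (X x @[x --> t^'-]).
Definition rgt (X : R -> V) (t : R) : V := lim (X x @[x --> t^'+]).

End Defs.

(* Main.v *)
Require Import Defs.
From HB Require Import structures.
From mathcomp Require Import all_boot all_order all_algebra all_fingroup.
From mathcomp Require Import all_classical all_reals all_analysis.
From mathcomp Require Import ring lra.
Set Implicit Arguments. Unset Strict Implicit. Unset Printing Implicit Defensive.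
Import Order.TTheory GRing.Theory Num.Theory.
Import numFieldNormedType.Exports.
Local Open Scope classical_set_scope.
Local Open Scope ring_scope.

(** Let r(x, y) be the Taylor remainder of order n of F.  It is jointly continuous
    and bounded by C |y - x|^(n+1), and the Taylor sum over a partition equals
    F(X_T) - F(X_0) minus the sum of the remainders r(X_a, X_b).  So one has to show
    that these remainders sum up, in the refinement sense, to the one-sided jumps.

    The p-variation yields a nondecreasing w with |X_b - X_a|^p <= w(b) - w(a).
    Subtract from r(X_a, X_b) the right jump at a and the left jump at b.  The
    result is at most e (w(b) - w(a)) when w(b) - w(a) is small, because
    p < n + 1.  Near a jump of w it tends to 0 while w(b) - w(a) stays bounded
    below.  Hence the bound holds on all short intervals on either side of a given
    point, and a supremum argument produces a finite set of points such that it
    holds on every interval that has none of them in its interior.  Summing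
    telescopes w. *)

(** * From local to global estimates on an interval *)

(** Let m be the supremum of a and the t with [Q a t]. The left hypothesis at m gives [Q a m] when a
    < m, and the right hypothesis would carry [Q] beyond m if m < b. *)
Lemma local_to_global (R : realType) (Q : R -> R -> Prop) (a b : R) :
  a < b ->
  (forall x y z, a <= x -> x < y -> y < z -> z <= b -> Q x y -> Q y z -> Q x z) ->
  (forall t, a <= t < b ->
     exists2 d, 0 < d & forall y, t < y < t + d -> y <= b -> Q t y) ->
  (forall t, a < t <= b ->
     exists2 d, 0 < d & forall x, t - d < x < t -> a <= x -> Q x t) ->
  Q a b.
Proof.
move=> ab Qtr Qr Ql.
pose S := [set t | a <= t <= b /\ (t = a \/ Q a t)].
have Sa : S a by split; [rewrite lexx ltW | left].
have supS : has_sup S by split; [exists a | exists b => t [/andP[]]].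
pose m := sup S.
have am : a <= m by apply: (ub_le_sup supS.2).
have mb : m <= b by apply: (ge_sup supS.1) => t [/andP[]].
have Sm : S m.
  move: am; rewrite le_eqVlt => /predU1P[<- //|am].
  have [d d0 hd] := Ql m (introT andP (conj am mb)).
  have [t St tm] := sup_adherent d0 supS.
  have := ub_le_sup supS.2 St; rewrite le_eqVlt => /predU1P[tE|ltm].
    by rewrite /m -tE.
  have [/andP[at_ tb] tQ] := St.
  have Qtm : Q t m by apply: hd => //; rewrite tm ltm.
  split; first by rewrite mb ltW.
  right; case: tQ => [<- //|Qat].
  move: at_; rewrite le_eqVlt => /predU1P[->//|at_].
  by apply: (Qtr _ t).
have [mltb|bm] := ltP m b; last first.
  have mE : m = b by apply/eqP; rewrite eq_le mb bm.
  by case: Sm.2; rewrite mE // => bE; move: ab; rewrite bE ltxx.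
have [d d0 hd] := Qr m (introT andP (conj am mltb)).
pose y := Num.min (m + d / 2) b.
have my : m < y by rewrite lt_min mltb andbT; lra.
have yb : y <= b by rewrite ge_min lexx orbT.
have Qmy : Q m y.
  apply: hd => //; rewrite my /= (le_lt_trans (_ : y <= m + d / 2)) //; last by lra.
  by rewrite ge_min lexx.
suff /(ub_le_sup supS.2) : S y by rewrite leNgt my.
split; first by rewrite yb andbT (le_trans am) // ltW.
right; case: Sm.2 => [<- //|Qam].
move: am; rewrite le_eqVlt => /predU1P[->//|am].
by apply: (Qtr _ m).
Qed.

(** The bound with slope [B + e] adds up over adjacent intervals and holds near each point on either
    side, hence on [a, b]; then e tends to 0. *)
Lemma mean_value_le (R : realType) (U : normedModType R) (g : R -> U)
    (B a b : R) : a <= b ->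
  (forall t e, a <= t <= b -> 0 < e -> exists2 d, 0 < d &
     forall s, a <= s <= b -> `|s - t| < d -> `|g s - g t| <= (B + e) * `|s - t|) ->
  `|g b - g a| <= B * (b - a).
Proof.
rewrite le_eqVlt => /predU1P[<-|ab] hg; first by rewrite !subrr normr0 mulr0.
apply/ler_addgt0Pr => e e0.
have ba0 : 0 < b - a by rewrite subr_gt0.
pose e' := e / (b - a).
have e'0 : 0 < e' by rewrite divr_gt0.
have -> : B * (b - a) + e = (B + e') * (b - a).
  by rewrite mulrDl divfK // gt_eqF.
apply: (@local_to_global R (fun x y => `|g y - g x| <= (B + e') * (y - x)) a b ab).
- move=> x y z _ _ _ _ xy yz.
  have -> : g z - g x = (g z - g y) + (g y - g x) by rewrite addrA subrK.
  rewrite (le_trans (ler_normD _ _)) // (le_trans (lerD yz xy)) //.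
  by rewrite -mulrDr addrA subrK.
- move=> t /andP[at_ tb]; have [|d d0 hd] := hg t e' _ e'0; first by rewrite at_ ltW.
  exists d => // y /andP[ty yt] yb.
  have := hd y; rewrite gtr0_norm ?subr_gt0 // => -> //; last by lra.
  by rewrite yb (le_trans at_) // ltW.
- move=> t /andP[at_ tb]; have [|d d0 hd] := hg t e' _ e'0; first by rewrite tb ltW.
  exists d => // y /andP[ty yt] yb.
  have := hd y; rewrite distrC (distrC (g y)) gtr0_norm ?subr_gt0 // => -> //; last by lra.
  by rewrite yb (le_trans _ tb) // ltW.
Qed.

(** * Taylor estimate for functions of a real variable *)

Section taylor_real.
Variables (R : realType) (U : normedModType R).
Implicit Types (c : nat -> U) (s t : R).

(** With the factorials, [c i] is the i-th derivative at 0 and differentiation is the shift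
    [c \o succn]. *)
Definition exp_poly N c s : U := \sum_(i < N) (s ^+ i / i`!%:R) *: c i.

Lemma pow_diff_quadratic i : exists2 K : R, 0 <= K &
  forall s t, 0 <= s <= 1 -> 0 <= t <= 1 ->
    `|s ^+ i.+1 - t ^+ i.+1 - (s - t) * (i.+1%:R * t ^+ i)| <= K * `|s - t| ^+ 2.
Proof.
elim: i => [|i [K K0 hK]].
  exists 0 => // s t _ _.
  by rewrite !expr1 expr0 !mulr1 subrr normr0 mul0r.
exists (K + i.+1%:R) => [|s t hs ht]; first by rewrite addr_ge0.
have -> : s ^+ i.+2 - t ^+ i.+2 - (s - t) * (i.+2%:R * t ^+ i.+1) =
  s * (s ^+ i.+1 - t ^+ i.+1 - (s - t) * (i.+1%:R * t ^+ i)) +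
  (s - t) ^+ 2 * (i.+1%:R * t ^+ i).
  by rewrite -[i.+2%:R]natr1 !exprS; ring.
have [/andP[s0 s1] /andP[t0 t1]] := (hs, ht).
rewrite (le_trans (ler_normD _ _)) // [leRHS]mulrDl lerD //.
  by rewrite normrM -[leRHS]mul1r ler_pM // ?(ger0_norm s0) // hK.
rewrite !normrM normrX mulrC ler_wpM2r ?exprn_ge0 //.
by rewrite normr_nat -[leRHS]mulr1 ler_wpM2l // (ger0_norm t0) exprn_ile1.
Qed.

Lemma exp_polyS N c s :
  exp_poly N.+1 c s = exp_poly N c s + (s ^+ N / N`!%:R) *: c N.
Proof. by rewrite /exp_poly big_ord_recr. Qed.

(** Termwise from the powers, as s^(N+1)/(N+1)! has derivative s^N/N!. *)
Lemma exp_poly_diff_quadratic N c : exists2 K : R, 0 <= K &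
  forall s t, 0 <= s <= 1 -> 0 <= t <= 1 ->
    `|exp_poly N.+1 c s - exp_poly N.+1 c t -
      (s - t) *: exp_poly N (c \o succn) t| <= K * `|s - t| ^+ 2.
Proof.
elim: N => [|N [K K0 hK]].
  exists 0 => // s t _ _.
  by rewrite /exp_poly !big_ord_recl !big_ord0 !expr0 subrr sub0r scaler0 oppr0 normr0 mul0r.
have [M M0 hM] := pow_diff_quadratic N.
exists (K + M * `|c N.+1|) => [|s t hs ht]; first by rewrite addr_ge0 // mulr_ge0.
rewrite !(exp_polyS N.+1) (exp_polyS N (c \o succn)) /=.
have factN : (N.+1`!%:R : R) = N.+1%:R * N`!%:R by rewrite -natrM factS.
have -> : exp_poly N.+1 c s + (s ^+ N.+1 / N.+1`!%:R) *: c N.+1 -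
    (exp_poly N.+1 c t + (t ^+ N.+1 / N.+1`!%:R) *: c N.+1) -
    (s - t) *: (exp_poly N (c \o succn) t + (t ^+ N / N`!%:R) *: c N.+1) =
  (exp_poly N.+1 c s - exp_poly N.+1 c t - (s - t) *: exp_poly N (c \o succn) t) +
  (N.+1`!%:R^-1 * (s ^+ N.+1 - t ^+ N.+1 - (s - t) * (N.+1%:R * t ^+ N))) *: c N.+1.
  have -> : t ^+ N / N`!%:R = N.+1`!%:R^-1 * (N.+1%:R * t ^+ N) :> R.
    by rewrite factN invfM mulrACA mulVf ?pnatr_eq0 // mul1r mulrC.
  have eqA (W : zmodType) (a b e x y z : W) :
      a + x - (b + y) - (e + z) = (a - b - e) + (x - y - z).
    by rewrite (opprD b) (addrACA a) (opprD e) (addrACA (a - b)).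
  rewrite scalerDr scalerA eqA; congr (_ + _).
  by rewrite -2!scalerBl; congr (_ *: _); ring.
rewrite (le_trans (ler_normD _ _)) // [leRHS]mulrDl lerD //; first exact: hK.
rewrite normrZ mulrAC ler_wpM2r // normrM -[leRHS]mul1r ler_pM // ?hM //.
rewrite ger0_norm ?invr_ge0 // invf_le1 ?ltr0n ?fact_gt0 // ler1n fact_gt0 //.
Qed.

(** Induction on N. The difference [h] of g 0 and its Taylor polynomial vanishes at 0; its
    derivative is the same difference for the shifted family, hence at most K. The mean value
    inequality gives K t <= K; the factor 1/N! is given up. *)
Lemma taylor_le (g : nat -> R -> U) (N : nat) (K : R) :
  (forall j t e, (j < N)%N -> 0 <= t <= 1 -> 0 < e -> exists2 d, 0 < d &
     forall s, 0 <= s <= 1 -> `|s - t| < d ->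
       `|g j s - g j t - (s - t) *: g j.+1 t| <= e * `|s - t|) ->
  (forall t, 0 <= t <= 1 -> `|g N t| <= K) ->
  forall t, 0 <= t <= 1 -> `|g 0%N t - exp_poly N (g ^~ 0) t| <= K.
Proof.
elim: N g => [|N IH] g hg hK t ht.
  by rewrite /exp_poly big_ord0 subr0 hK.
have K0 : 0 <= K by apply: le_trans (hK t ht).
pose h s := g 0%N s - exp_poly N.+1 (g ^~ 0) s.
have h0 : h 0 = 0.
  rewrite /h /exp_poly big_ord_recl /= big1 => [|i _].
    by rewrite expr0 fact0 divr1 scale1r addr0 subrr.
  by rewrite expr0n /= mul0r scale0r.
have IH1 s : 0 <= s <= 1 -> `|g 1%N s - exp_poly N ((g ^~ 0) \o succn) s| <= K.
  apply: (IH (fun j => g j.+1)) => [j u e jN hu e0|u hu]; last exact: hK.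
  exact: hg.
have /andP[t0 t1] := ht.
rewrite -/(h t) -[h t]subr0 -h0 (le_trans (_ : _ <= K * (t - 0))) //; last first.
  by rewrite subr0 -[leRHS]mulr1 ler_wpM2l.
apply: mean_value_le => // u e /andP[u0 ut] e0.
have hu : 0 <= u <= 1 by rewrite u0 (le_trans ut).
have [M M0 hM] := exp_poly_diff_quadratic N (g ^~ 0).
have [|d d0 hd] := hg 0%N u (e / 2) (ltn0Sn _) hu; first by rewrite divr_gt0.
(* With this [d'] the quadratic error of the polynomial costs at most e/2 |s - t|; the other half of
   e goes to g 0. *)
pose d' := e / 2 / (M + 1).
have M1 : 0 < M + 1 by rewrite ltr_wpDl.
have d'0 : 0 < d' by rewrite !divr_gt0.
exists (Num.min d d'); first by rewrite lt_min d0 d'0.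
move=> s /andP[s0 st]; rewrite lt_min => /andP[sd sd'].
have hs : 0 <= s <= 1 by rewrite s0 (le_trans st).
pose A := g 0%N s - g 0%N u - (s - u) *: g 1%N u.
pose B := exp_poly N.+1 (g ^~ 0) s - exp_poly N.+1 (g ^~ 0) u -
  (s - u) *: exp_poly N ((g ^~ 0) \o succn) u.
have -> : h s - h u =
    (s - u) *: (g 1%N u - exp_poly N ((g ^~ 0) \o succn) u) + (A - B).
  rewrite /A /B /h scalerBr.
  have eqB (W : zmodType) (a b c f x y : W) :
      (a - c) - (b - f) = (x - y) + ((a - b - x) - (c - f - y)).
    rewrite (opprB (c - f)) addrACA [x + _]addrC subrK addKr.
    by rewrite !opprB (addrACA a (- c)) (addrACA a (- b)) [- c - b]addrC.
  exact: eqB.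
rewrite (le_trans (ler_normD _ _)) // mulrDl lerD //.
  by rewrite normrZ mulrC ler_wpM2r // IH1.
rewrite (le_trans (ler_normB _ _)) // [e]splitr mulrDl lerD //; first exact: hd.
rewrite (le_trans (hM _ _ hs hu)) // expr2 mulrA ler_wpM2r //.
have -> : e / 2 = (M + 1) * d' by rewrite [RHS]mulrC divfK ?gt_eqF.
by rewrite ler_pM // ?lerDl // ltW.
Qed.
End taylor_real.

(** * Multilinear maps evaluated on the diagonal *)

Section multilinear_maps.
Variables (R : realType) (V U : completeNormedModType R).
Implicit Types (k : nat) (v : V).

Lemma ffnorm_diag k v : ffnorm [ffun _ : 'I_k => v] = `|v| ^+ k.
Proof.
rewrite /ffnorm (eq_bigr (fun=> `|v|)) => [|i _]; last by rewrite ffunE.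
by rewrite big_const_ord iter_mulr_1.
Qed.

Lemma ffcons_diag k v : ffcons v [ffun _ : 'I_k => v] = [ffun=> v].
Proof. by apply/ffunP => j; rewrite !ffunE; case: unliftP => [?|]; rewrite ?ffunE. Qed.

Lemma multilinear_set0 k (L : {ffun 'I_k -> V} -> U) h i :
  multilinear L -> L (ffset h i 0) = 0.
Proof.
move=> lin; have := lin h i 1 0 0; rewrite scaler0 addr0 scale1r => /eqP.
by rewrite -subr_eq0 opprD addrA subrr add0r oppr_eq0 => /eqP.
Qed.

Lemma multilinear_consZ k (L : {ffun 'I_k.+1 -> V} -> U) a v h :
  multilinear L -> L (ffcons (a *: v) h) = a *: L (ffcons v h).
Proof.
move=> lin.
have consE w : ffcons w h = ffset (ffcons v h) ord0 w.
  apply/ffunP => j; rewrite !ffunE.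
  by case: unliftP => [j' ->|->]; rewrite ?eqxx // eq_sym (negPf (neq_lift _ _)) ffunE.
by rewrite consE -[a *: v]addr0 lin -consE multilinear_set0 // addr0.
Qed.

Lemma multilinear_setB k (L : {ffun 'I_k -> V} -> U) h i v w :
  multilinear L -> L (ffset h i v) - L (ffset h i w) = L (ffset h i (v - w)).
Proof. by move=> lin; rewrite [v - w]addrC -(scaleN1r w) lin scaleN1r addrC. Qed.

(* Replace the arguments [a] by [b] one at a time. *)
Lemma multilinear_diag_lipschitz k (L : {ffun 'I_k -> V} -> U) (C M : R) a b :
  multilinear L -> 0 <= C -> (forall h, `|L h| <= C * ffnorm h) ->
  `|a| <= M -> `|b| <= M ->
  `|L [ffun=> b] - L [ffun=> a]| <= k%:R * (C * M ^+ k.-1) * `|b - a|.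
Proof.
move=> lin C0 LC aM bM.
have M0 : 0 <= M by apply: le_trans aM.
pose hyb (i : nat) : {ffun 'I_k -> V} := [ffun j : 'I_k => if (j < i)%N then b else a].
have -> : [ffun=> b] = hyb k by apply/ffunP => j; rewrite !ffunE ltn_ord.
have -> : [ffun=> a] = hyb 0%N by apply/ffunP => j; rewrite !ffunE.
rewrite -(telescope_sumr (fun i => L (hyb i))) // big_mkord.
rewrite (le_trans (ler_norm_sum _ _ _)) //.
rewrite -mulrA -[k in leRHS]card_ord mulr_natl -sumr_const.
apply: ler_sum => i _.
have -> : hyb i.+1 = ffset (hyb i) i b.
  apply/ffunP => j; rewrite !ffunE ltnS leq_eqVlt.
  by rewrite -[(j : nat) == i]/(j == i); case: (j == i).
have {2}-> : hyb i = ffset (hyb i) i a.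
  apply/ffunP => j; rewrite !ffunE.
  by case: eqVneq => // ->; rewrite ltnn.
rewrite multilinear_setB // (le_trans (LC _)) // -mulrA ler_wpM2l //.
rewrite /ffnorm (bigD1 i) //= ffunE eqxx mulrC ler_wpM2r //.
rewrite -(cardC1 i) -prodr_const.
apply: ler_prod => j ji; rewrite normr_ge0 /= ffunE (negPf ji) ffunE.
by case: ifP.
Qed.
End multilinear_maps.

(** * The Taylor remainder of F: bound and joint continuity *)

Section smooth_maps.
Variables (R : realType) (V U : completeNormedModType R) (n : nat).
Variables (F : V -> U) (D : forall k : nat, V -> {ffun 'I_k -> V} -> U).
Hypothesis CbF : Cb n.+1 F D.

Lemma Cb_bound j : (j <= n.+1)%N ->
  exists2 C : R, 0 <= C & forall x h, `|@D j x h| <= C * ffnorm h.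
Proof.
case: CbF => _ _ _ _ bnd jn; have [C hC] := bnd _ jn.
exists `|C| => // x h; rewrite (le_trans (hC x h)) // ler_wpM2r ?ler_norm //.
by rewrite prodr_ge0.
Qed.

Lemma Cb_multilinear j x : (j <= n.+1)%N -> multilinear (@D j x).
Proof. by case: CbF => _ ml _ _ _ /(ml _ x)[]. Qed.

(** The difference is the linearisation error plus D^(j+1)(x) applied to y - x, together at most (1
    + C) |y - x| times [ffnorm h]. *)
Lemma Cb_continuous j x (e : R) : (j <= n)%N -> 0 < e -> exists2 d : R, 0 < d &
  forall y, `|y - x| < d -> forall h, `|@D j y h - @D j x h| <= e * ffnorm h.
Proof.
move=> jn e0; have [C C0 hC] := Cb_bound (jn : (j < n.+1)%N).
have [_ _ /(_ j jn x 1 ltr01)[d d0 hd] _ _] := CbF.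
have C1 : 0 < C + 1 by rewrite ltr_wpDl.
exists (Num.min d (e / (C + 1))); first by rewrite lt_min d0 divr_gt0.
move=> y; rewrite lt_min => /andP[yd ye] h.
have h0 : 0 <= ffnorm h by rewrite prodr_ge0.
have consE : ffnorm (ffcons (y - x) h) = `|y - x| * ffnorm h.
  rewrite /ffnorm big_ord_recl; congr (_ * _); first by rewrite ffunE unlift_none.
  by apply: eq_bigr => i _; rewrite ffunE liftK.
have -> : D y h - D x h = (D y h - D x h - D x (ffcons (y - x) h)) +
   D x (ffcons (y - x) h) by rewrite subrK.
rewrite (le_trans (ler_normD _ _)) // (le_trans (lerD (hd _ yd h) (hC _ _))) //.
rewrite consE mul1r mulrA -mulrDl ler_wpM2r // -[X in X + _]mul1r -mulrDl addrC.
by rewrite mulrC -ler_pdivlMr // ltW.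
Qed.

(** Frechet differentiability in the direction (s - t) v, the scalar being pulled out of the first
    slot. It makes the derivatives along a line a family for [taylor_le]. *)
Lemma Cb_line_derivative x v j t (e : R) : (j <= n)%N -> 0 < e ->
  exists2 d, 0 < d & forall s, `|s - t| < d ->
    `|@D j (x + s *: v) [ffun=> v] - @D j (x + t *: v) [ffun=> v] -
      (s - t) *: @D j.+1 (x + t *: v) [ffun=> v]| <= e * `|s - t|.
Proof.
move=> jn e0.
(* Dividing e by [q] absorbs the factor |v|^(j+1) of the error; the 1 keeps [q] positive when v =
   0. *)
pose q := `|v| ^+ j.+1 + 1.
have q0 : 0 < q by rewrite ltr_wpDl ?exprn_ge0.
have eq0 : 0 < e / q by rewrite divr_gt0.
have [_ _ /(_ j jn (x + t *: v) _ eq0)[d d0 hd] _ _] := CbF.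
have v1 : 0 < `|v| + 1 by rewrite ltr_wpDl.
exists (d / (`|v| + 1)) => [|s sd]; first by rewrite divr_gt0.
have yE : x + s *: v - (x + t *: v) = (s - t) *: v.
  by rewrite opprD addrACA subrr add0r scalerBl.
have := hd (x + s *: v); rewrite yE => /(_ _ [ffun=> v]).
rewrite multilinear_consZ; last exact: Cb_multilinear.
rewrite ffcons_diag ffnorm_diag => hs; rewrite (le_trans (hs _)) //.
  rewrite normrZ (le_lt_trans (_ : _ <= `|s - t| * (`|v| + 1))) //.
    by rewrite ler_wpM2l // lerDl.
  by rewrite -ltr_pdivlMr.
have -> : e / q * `|(s - t) *: v| * `|v| ^+ j = `|s - t| * (e * (`|v| ^+ j.+1 / q)).
  by rewrite normrZ exprSr; ring.
by rewrite mulrC ler_wpM2r // ler_piMr ?(ltW e0) // ler_pdivrMr // mul1r lerDl.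
Qed.

Definition remainder x y : U := F y - F x - taylor D n x (y - x).

(** This is [taylor_le] at t = 1, along the segment from x to y. *)
Lemma remainder_bound :
  exists2 C : R, 0 <= C & forall x y, `|remainder x y| <= C * `|y - x| ^+ n.+1.
Proof.
have [C C0 hC] := Cb_bound (leqnn n.+1).
exists C => // x y; pose v := y - x.
pose g (j : nat) (t : R) := @D j (x + t *: v) [ffun=> v].
have := @taylor_le R U g n.+1 (C * `|v| ^+ n.+1) _ _ 1 _.
have D0 z h : @D 0%N z h = F z by case: CbF.
have xv : x + v = y by rewrite /v addrC subrK.
have -> : g 0%N 1 - exp_poly n.+1 (g ^~ 0) 1 = remainder x y.
  rewrite /remainder /g D0 scale1r xv -addrA -opprD; congr (_ - _).
  rewrite /exp_poly big_ord_recl /= expr0 divr1 scale1r D0 scale0r addr0.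
  congr (_ + _); rewrite /taylor big_add1 /= big_mkord.
  by apply: eq_bigr => i _; rewrite expr1n mul1r /bump add1n.
apply; last by rewrite ler01 lexx.
- move=> j t e jn _ e0; have [d d0 hd] := Cb_line_derivative x v t jn e0.
  by exists d => // s _; exact: hd.
- by move=> t _; rewrite -ffnorm_diag; apply: hC.
Qed.

(** First the base point moves, by continuity in operator norm; then the argument moves, by the
    Lipschitz bound on the ball of radius |h| + 1. *)
Lemma Cb_diag_cvg (T : Type) (G : set_system T) (FG : Filter G) (j : nat)
    (f g : T -> V) (x h : V) : (j <= n)%N ->
  f @ G --> x -> g @ G --> h ->
  @D j (f t) [ffun=> g t] @[t --> G] --> @D j x [ffun=> h].
Proof.
move=> jn fx gh; apply/cvgrPdist_le => e e0.
have [C C0 hC] := Cb_bound (leqW jn).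
pose M := `|h| + 1.
have M0 : 0 < M by rewrite ltr_wpDl.
have e2 : 0 < e / 2 by rewrite divr_gt0.
have [d d0 hd] := @Cb_continuous j x (e / 2 / M ^+ j) jn (divr_gt0 e2 (exprn_gt0 j M0)).
pose K := j%:R * (C * M ^+ j.-1) + 1.
have K0 : 0 < K by rewrite ltr_wpDl // !mulr_ge0 // exprn_ge0 // ltW.
near=> t.
have gM : `|g t| <= M.
  rewrite -[g t](subrK h) (le_trans (ler_normD _ _)) // addrC lerD //.
  by near: t; apply: cvgr_distC_le gh _ ltr01.
have fd : `|f t - x| < d by near: t; apply: cvgr_distC_lt fx _ d0.
have gK : `|g t - h| <= e / 2 / K.
  by near: t; apply: cvgr_distC_le gh _ _; rewrite divr_gt0.
rewrite distrC.
rewrite -(subrK (@D j x [ffun=> g t]) (@D j (f t) _)) -addrA.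
rewrite (le_trans (ler_normD _ _)) // [leRHS]splitr lerD //.
  rewrite (le_trans (hd _ fd _)) // ffnorm_diag -(mulrA (e / 2)) ler_piMr ?(ltW e2) //.
  by rewrite mulrC ler_pdivrMr ?exprn_gt0 // mul1r lerXn2r ?nnegrE // ltW.
have hM : `|h| <= M by rewrite lerDl.
rewrite (le_trans (multilinear_diag_lipschitz _ C0 (hC x) hM gM)) //.
  exact: Cb_multilinear (leqW jn).
rewrite (le_trans (_ : _ <= K * `|g t - h|)) ?ler_wpM2r ?lerDl //.
by rewrite mulrC -ler_pdivlMr.
Unshelve. all: by end_near. Qed.

(** Stated for an arbitrary filter, so as to cover both one-sided limits at a time t, with one
    argument held constant. *)
Lemma remainder_cvg (T : Type) (G : set_system T) (FG : Filter G)
    (f g : T -> V) (x y : V) : f @ G --> x -> g @ G --> y ->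
  remainder (f t) (g t) @[t --> G] --> remainder x y.
Proof.
move=> fx gy.
have Fcvg k z : k @ G --> z -> F (k t) @[t --> G] --> F z.
  have D0 u (h : V) : F u = @D 0%N u [ffun=> h] by case: CbF => ->.
  move=> kz; rewrite (D0 z z).
  under eq_fun => t do rewrite (D0 _ (k t)).
  exact: Cb_diag_cvg.
apply: cvgB; first by apply: cvgB; exact: Fcvg.
rewrite /taylor; move: (leqnn n); elim: {-2}n => [_|N IH Nn].
  rewrite big_geq //; under eq_fun => t do rewrite big_geq //.
  exact: cvg_cst.
rewrite big_nat_recr //=; under eq_fun => t do rewrite big_nat_recr //=.
apply: cvgD; first exact: IH (ltnW Nn).
by apply: cvgZ; [exact: cvg_cst | apply: Cb_diag_cvg => //; exact: cvgB].
Qed.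
End smooth_maps.

(** * Unconditional sums over a set of times *)

Lemma big_uniq_subset (I : eqType) (W : nmodType) (s0 s : seq I) (g : I -> W) :
  uniq s0 -> uniq s -> {subset s0 <= s} ->
  \sum_(t <- s) g t = \sum_(t <- s0) g t + \sum_(t <- s | t \notin s0) g t.
Proof.
move=> us0 us s0s; rewrite -[X in _ + X]big_filter -big_cat; apply: perm_big.
apply: uniq_perm => // [|t].
  rewrite cat_uniq us0 filter_uniq // andbT /=; apply/hasPn => t.
  by rewrite mem_filter => /andP[].
rewrite mem_cat mem_filter; case: (boolP (t \in s0)) => //= /s0s -> //.
Qed.

Section absolute_summability.
Variables (R : realType) (U : completeNormedModType R).
Variables (A : set R) (J : R -> U) (M : R).
Hypothesis sum_le : forall s : seq R, uniq s -> {subset s <= A} ->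
  \sum_(t <- s) `|J t| <= M.

(** The list [s0] comes within e of the supremum of the finite sums of norms, so further terms add
    less than e. *)
Lemma abs_sum_tail (e : R) : 0 < e ->
  exists s0 : seq R, [/\ uniq s0, {subset s0 <= A} &
    forall s, uniq s -> {subset s <= A} -> {subset s0 <= s} ->
      \sum_(t <- s | t \notin s0) `|J t| < e].
Proof.
move=> e0.
pose E := [set x : R | exists s : seq R,
  [/\ uniq s, {subset s <= A} & x = \sum_(t <- s) `|J t|]].
have supE : has_sup E.
  split; first by exists 0, [::]; split => //; rewrite big_nil.
  by exists M => _ [s [us sA ->]]; exact: sum_le.
have [_ [s0 [us0 s0A ->]] lt_s0] := sup_adherent e0 supE.
exists s0; split => // s us sA s0s.
have : \sum_(t <- s) `|J t| <= sup E by apply: (ub_le_sup supE.2); exists s.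
rewrite (big_uniq_subset _ us0 us s0s); lra.
Qed.

(** Finite subsets of A directed by inclusion: a limit along this filter is the sum in the sense of
    [abs_sum]. *)
Definition finite_subsets : set_system (seq R) :=
  [set B | exists s0 : seq R, uniq s0 /\ {subset s0 <= A} /\
     forall s : seq R, uniq s -> {subset s <= A} -> {subset s0 <= s} -> B s].

#[local] Instance finite_subsets_filter : ProperFilter finite_subsets.
Proof.
split=> [[s0 [us0 [s0A /(_ s0 us0 s0A (fun _ => id))]]] //|].
split.
- by exists [::]; split.
- move=> P Q [s1 [us1 [s1A h1]]] [s2 [us2 [s2A h2]]].
  exists (undup (s1 ++ s2)); split; first exact: undup_uniq.
  split=> [t|s us sA ss].
    by rewrite mem_undup mem_cat => /orP[/s1A|/s2A].
  split; [apply: h1 => // | apply: h2 => //] => t ts;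
    by apply: ss; rewrite mem_undup mem_cat ts ?orbT.
- move=> P Q PQ [s0 [us0 [s0A h]]]; exists s0; split => //; split => // s us sA ss.
  by apply: PQ; exact: h.
Qed.

(** The partial sums are Cauchy along [finite_subsets] by the tail estimate, and U is complete. *)
Lemma abs_sum_exists : exists S : U, abs_sum A J S.
Proof.
pose y (s : seq R) : U := \sum_(t <- s) J t.
have /cauchy_cvgP/cvg_ex[S yS] : cauchy (y @ finite_subsets).
  apply: cauchy_exP => e e0.
  have [s0 [us0 s0A hs0]] := abs_sum_tail e0.
  exists (y s0), s0; split => //; split => // s us sA ss.
  rewrite /= -ball_normE /= distrC /y (big_uniq_subset _ us0 us ss) addrAC subrr add0r.
  exact: le_lt_trans (ler_norm_sum _ _ _) (hs0 _ us sA ss).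
exists S; split; last first.
- move=> e e0; have /cvgrPdistC_lt/(_ e e0)[s0 [us0 [s0A h]]] := yS.
  by exists s0; split => //; split => // s us sA ss; exact: h.
- by exists M.
(* Countability: all nonzero terms lie in the union of the finite lists [s k]. *)
have /choice[s hs] : forall k : nat, exists s0 : seq R, [/\ uniq s0, {subset s0 <= A} &
    forall s, uniq s -> {subset s <= A} -> {subset s0 <= s} ->
      \sum_(t <- s | t \notin s0) `|J t| < k.+1%:R^-1].
  by move=> k; apply: abs_sum_tail; rewrite invr_gt0.
apply: (@sub_countable _ _ _ (\bigcup_(k in setT) [set` s k])); last first.
  apply: bigcup_countable => // k _; apply: finite_set_countable.
  exact: finite_seq.
apply: subset_card_le => t [At Jt]; apply: contrapT => nt.
have ntk k : t \notin s k by apply/negP => tk; apply: nt; exists k.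
(* Adjoin t to [s k]: [J t] is then the only term outside [s k]. *)
have Jle k : `|J t| < k.+1%:R^-1.
  have [us sA] := hs k; move=> /(_ (t :: s k)); rewrite big_cons /= ntk /= us.
  rewrite -big_filter (_ : [seq _ <- _ | _] = [::]) ?big_nil ?addr0; last first.
    by apply/eqP; rewrite -[_ == _]negbK -has_filter; apply/hasPn => u ->.
  apply => // u; rewrite in_cons; first by move=> /orP[/eqP ->|/sA //]; exact: mem_set.
  by move=> ->; rewrite orbT.
have J0 : 0 < `|J t| by rewrite normr_gt0.
(* For k the integer part of 1/|J t|, one has 1/(k+1) <= |J t|, a contradiction. *)
have := Jle (Num.truncn `|J t|^-1).
rewrite ltNge => /negP; apply.
rewrite invf_ple ?posrE ?ltr0n // ltW //.
have J1 : 0 <= `|J t|^-1 by rewrite invr_ge0.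
by have /andP[] := truncn_itv J1.
Qed.
End absolute_summability.

Lemma abs_sum_const0 (R : realType) (U : completeNormedModType R)
    (A : set R) (J : R -> U) (S : U) :
  abs_sum A J S -> (forall t, A t -> J t = 0) -> S = 0.
Proof.
move=> [_ _ hS] J0; apply/eqP; rewrite -normr_eq0 eq_le normr_ge0 andbT.
apply/ler_addgt0Pr => e e0; rewrite add0r; have [s [us [sA /(_ s us sA (fun _ => id))]]] := hS e e0.
rewrite big_seq big1 => [|t /sA]; first by rewrite sub0r normrN => /ltW.
by rewrite inE => /J0.
Qed.

(** * Partitions, and a control function for the p-variation *)

Section partitions.
Variable R : realType.
Implicit Types (x T : R) (s : seq R).

Lemma partition_through T (l : seq R) : 0 < T ->
  exists2 s, is_partition T s & forall t, t \in l -> 0 < t <= T -> t \in s.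
Proof.
move=> T0; pose s := sort <=%R (undup [seq t <- l | 0 < t < T]).
have sE t : (t \in s) = (0 < t < T) && (t \in l).
  by rewrite mem_sort mem_undup mem_filter.
have s_sorted : sorted <%R s.
  by rewrite lt_sorted_uniq_le sort_uniq undup_uniq sort_le_sorted.
exists (rcons s T) => [|t tl /andP[t0]].
  rewrite /is_partition last_rcons eqxx andbT rcons_path.
  rewrite (path_sortedE lt_trans) s_sorted andbT; apply/andP; split.
    by apply/allP => t; rewrite sE => /andP[/andP[]].
  by have := mem_last 0 s; rewrite inE sE => /orP[/eqP ->//|/andP[/andP[]]].
rewrite le_eqVlt mem_rcons inE sE tl t0 andbT /= => /orP[->//|->].
by rewrite orbT.
Qed.

Lemma path_lt_mem x s t : path <%R x s -> t \in x :: s -> x <= t <= last x s.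
Proof.
elim: s x t => [|y s IH] x t /=; first by rewrite inE => _ /eqP ->; rewrite lexx.
move=> /andP[xy ps]; rewrite inE => /predU1P[->|/(IH _ _ ps)/andP[yt ->]].
  have /andP[_] := IH _ _ ps (mem_head _ _).
  by rewrite lexx /=; exact: le_trans (ltW xy).
by rewrite (le_trans (ltW xy) yt).
Qed.

Lemma partition_mem T s t : is_partition T s -> t \in 0 :: s -> 0 <= t <= T.
Proof. by move=> /andP[ps /eqP <-]; exact: path_lt_mem. Qed.

Lemma partition_uniq T s : is_partition T s -> uniq (0 :: s).
Proof. by move=> /andP[ps _]; exact: (@lt_sorted_uniq _ _ (0 :: s)). Qed.

Lemma partition_belast T s t : is_partition T s ->
  (t \in belast 0 s) = (t \in 0 :: s) && (t < T).
Proof.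
move=> sT; have [ps /eqP lastT] := andP sT.
have := partition_uniq sT; rewrite lastI lastT rcons_uniq => /andP[TN _].
rewrite mem_rcons inE.
have [-> |tN] := eqVneq t T; first by rewrite (negPf TN) ltxx andbF.
rewrite /=; case: (boolP (t \in belast 0 s)) => //= tb.
have /andP[_ tT] : 0 <= t <= T.
  by apply: (partition_mem sT); rewrite lastI mem_rcons inE tb orbT.
by rewrite lt_neqAle tN tT.
Qed.

Lemma psum_fst s (W : nmodType) (g : R -> W) :
  psum s (fun a _ => g a) = \sum_(t <- belast 0 s) g t.
Proof.
rewrite /psum; elim: s (0 : R) => [|y s IH] x /=; first by rewrite !big_nil.
by rewrite !big_cons IH.
Qed.

Lemma psum_snd s (W : nmodType) (g : R -> W) :
  psum s (fun _ b => g b) = \sum_(t <- s) g t.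
Proof.
rewrite /psum; elim: s (0 : R) => [|y s IH] x /=; first by rewrite !big_nil.
by rewrite !big_cons IH.
Qed.

Lemma psum_telescope s (W : zmodType) (g : R -> W) :
  psum s (fun a b => g b - g a) = g (last 0 s) - g 0.
Proof.
rewrite /psum; elim: s (0 : R) => [|y s IH] x /=; first by rewrite big_nil subrr.
by rewrite big_cons IH addrC addrA subrK.
Qed.

Lemma psum_rcons s b (W : nmodType) (f : R -> R -> W) :
  psum (rcons s b) f = psum s f + f (last 0 s) b.
Proof.
rewrite /psum; elim: s (0 : R) => [|y s IH] x /=.
  by rewrite big_cons !big_nil addr0 add0r.
by rewrite !big_cons IH addrA.
Qed.

(** The increments of w telescope. Neighbouring points are described as two points with none of [s]
    strictly between, the form in which exceptional points are excluded later. *)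
Lemma psum_norm_le (U : normedModType R) s (f : R -> R -> U) (w : R -> R) :
  path <%R 0 s ->
  (forall c d, c \in 0 :: s -> d \in 0 :: s -> c < d ->
     (forall u, u \in s -> ~~ (c < u < d)) -> `|f c d| <= w d - w c) ->
  `|psum s f| <= w (last 0 s) - w 0.
Proof.
rewrite /psum; elim: s (0 : R) => [|y s IH] x /=; first by rewrite big_nil normr0 subrr.
move=> /andP[xy ps] hf; rewrite big_cons (le_trans (ler_normD _ _)) //=.
have -> : w (last y s) - w x = (w y - w x) + (w (last y s) - w y).
  by rewrite [RHS]addrC addrA subrK.
move: (ps); rewrite (path_sortedE lt_trans) => /andP[/allP ys _].
rewrite lerD //.
  apply: hf => //; rewrite ?inE ?eqxx ?orbT // => u.
  rewrite inE => /orP[/eqP->|/ys yu]; first by rewrite ltxx andbF.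
  by apply/negP => /andP[_ /(lt_trans yu)]; rewrite ltxx.
apply: IH => // c d cs ds cd ncd; apply: hf => //; rewrite ?inE.
- by move: cs; rewrite inE => ->; rewrite orbT.
- by move: ds; rewrite inE => ->; rewrite orbT.
move=> u; rewrite inE => /orP[/eqP->|/ncd //].
move: cs; rewrite inE => /orP[/eqP->|/ys yc]; first by rewrite ltxx.
by apply/negP => /andP[/(lt_trans yc)]; rewrite ltxx.
Qed.

(** Take for [w t] the p-th power of the p-variation on [0, t]. A partition of [0, a] followed by b
    is one of [0, b], whence the inequality. *)
Lemma pvar_control (V : completeNormedModType R) (p T : R) (X : R -> V) :
  0 < T -> finite_pvar p T X ->
  exists w : R -> R, forall a b, 0 <= a -> a < b -> b <= T ->
    `|X b - X a| `^ p <= w b - w a.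
Proof.
move=> T0 [M hM].
pose v s := psum s (fun a b => `|X b - X a| `^ p).
pose E t := [set v s | s in [set s | is_partition t s]].
have Eub t : t <= T -> has_ubound (E t).
  rewrite le_eqVlt => /predU1P[->|tT].
    by exists M => _ [s sT <-]; exact: hM.
  (* Appending T to a partition of [0, t] bounds its sum by M. *)
  exists M => _ [s /andP[ps /eqP ls] <-].
  apply: le_trans (hM (rcons s T) _); last first.
    by rewrite /is_partition last_rcons eqxx rcons_path ps ls tT.
  by rewrite psum_rcons lerDl powR_ge0.
exists (fun t => sup (E t)) => a b a0 ab bT.
have Ene : E a !=set0.
  move: a0; rewrite le_eqVlt => /predU1P[<-|a0].
    by exists (v [::]), [::] => //; rewrite /= /is_partition /= eqxx.
  by exists (v [:: a]), [:: a] => //; rewrite /= /is_partition /= a0 eqxx.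
rewrite lerBrDr addrC -lerBrDr; apply: ge_sup => // _ [s /andP[ps /eqP ls] <-].
rewrite lerBrDr; apply: ub_le_sup (Eub _ bT) _ _; exists (rcons s b).
  by rewrite /= /is_partition last_rcons eqxx rcons_path ps ls ab.
by rewrite /v psum_rcons ls.
Qed.
End partitions.

(** * One-sided limits of a controlled path *)

Section controlled_path.
Variables (R : realType) (V : completeNormedModType R).
Variables (p T : R) (X : R -> V) (w : R -> R).
Hypothesis p0 : 0 < p.
Implicit Types a b c d e t : R.
Hypothesis Xw : forall a b, 0 <= a -> a < b -> b <= T ->
  `|X b - X a| `^ p <= w b - w a.

Lemma control_le a b : 0 <= a -> a <= b -> b <= T -> w a <= w b.
Proof.
move=> a0; rewrite le_eqVlt => /predU1P[-> //|ab bT].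
by rewrite -subr_ge0 (le_trans _ (Xw a0 ab bT)) // powR_ge0.
Qed.

(** Once the nondecreasing w is within e of its supremum over [0, t), it cannot grow by more than e
    before t. The value at t is left out, since w may jump there. *)
Lemma control_small_left t e : 0 < t -> t <= T -> 0 < e ->
  exists d, [/\ 0 < d, 0 <= t - d &
    forall a b, t - d < a -> a <= b -> b < t -> w b - w a <= e].
Proof.
move=> t0 tT e0; pose E := [set w a | a in [set a | 0 <= a < t]].
have supE : has_sup E.
  split; first by exists (w 0), 0 => //=; rewrite lexx.
  by exists (w t) => _ [a /= /andP[a0 at_] <-]; rewrite control_le // ltW.
have [_ [a0 /= /andP[a00 a0t] <-] lt_a0] := sup_adherent e0 supE.
exists (t - a0); rewrite subr_gt0 subKr; split=> // a b a0a ab bt.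
have wb : w b <= sup E.
  apply: ub_le_sup supE.2 _ _; exists b => //=.
  by rewrite bt (le_trans a00) // (le_trans (ltW a0a)).
have wa : w a0 <= w a.
  by rewrite control_le // ?ltW // (le_lt_trans ab) // (lt_le_trans bt).
lra.
Qed.

Lemma control_small_right t e : 0 <= t -> t < T -> 0 < e ->
  exists d, [/\ 0 < d, t + d <= T &
    forall a b, t < a -> a <= b -> b < t + d -> w b - w a <= e].
Proof.
move=> t0 tT e0; pose E := [set - w b | b in [set b | t < b <= T]].
have supE : has_sup E.
  split; first by exists (- w T), T => //=; rewrite lexx tT.
  by exists (- w t) => _ [a /= /andP[ta aT] <-]; rewrite lerN2 control_le // ltW.
have [_ [b0 /= /andP[tb0 b0T] <-] lt_b0] := sup_adherent e0 supE.
exists (b0 - t); rewrite subr_gt0 addrC subrK; split=> // a b ta ab bb0.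
have wa : - w a <= sup E.
  apply: ub_le_sup supE.2 _ _; exists a => //=.
  by rewrite ta (le_trans ab) // (le_trans (ltW bb0)).
have wb : w b <= w b0.
  by rewrite control_le // ?(ltW bb0) // (le_trans t0) // (le_trans (ltW ta)).
lra.
Qed.

Lemma powR_le_inv (z u : R) : 0 <= z -> 0 <= u -> z `^ p <= u -> z <= u `^ p^-1.
Proof.
move=> z0 u0 zu; have -> : z = (z `^ p) `^ p^-1.
  by rewrite -powRrM divff ?gt_eqF // powRr1.
by rewrite ge0_ler_powR ?nnegrE ?powR_ge0 ?invr_ge0 ?(ltW p0).
Qed.

Lemma powR_inv_le (z u : R) : 0 <= z -> 0 <= u -> z <= u `^ p^-1 -> z `^ p <= u.
Proof.
move=> z0 u0 zu; have -> : u = (u `^ p^-1) `^ p.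
  by rewrite -powRrM mulVf ?gt_eqF // powRr1.
by rewrite ge0_ler_powR ?nnegrE ?powR_ge0 ?(ltW p0).
Qed.

(** Where w grows by at most (e/2)^p, X moves by at most e/2; so X is Cauchy at t from the left, and
    V is complete. *)
Lemma lft_cvg t : 0 < t -> t <= T -> X x @[x --> t^'-] --> lft X t.
Proof.
move=> t0 tT; suff : cvg (X x @[x --> t^'-]) by [].
apply/cauchy_cvgP/cauchy_exP => e e0.
have ep : 0 < (e / 2) `^ p by rewrite powR_gt0 // divr_gt0.
have [d [d0 td hd]] := control_small_left t0 tT ep.
have td2 : t - d / 2 < t by lra.
exists (X (t - d / 2)).
suff : \forall a \near t^'-, ball (X (t - d / 2)) e (X a) by [].
near=> a.
have ta : t - d / 2 < a by near: a; apply: nbhs_left_gt.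
have at_ : a < t by near: a; apply: nbhs_left_lt.
rewrite /= -ball_normE /= distrC (le_lt_trans (_ : _ <= e / 2)) //; last by lra.
have := powR_le_inv (normr_ge0 (X a - X (t - d / 2))) (ltW ep).
rewrite -powRrM divff ?gt_eqF // powRr1; last by rewrite ltW // divr_gt0.
apply; apply: (le_trans (Xw _ _ _)) => //; try lra.
by apply: hd => //; lra.
Unshelve. all: by end_near. Qed.

Lemma rgt_cvg t : 0 <= t -> t < T -> X x @[x --> t^'+] --> rgt X t.
Proof.
move=> t0 tT; suff : cvg (X x @[x --> t^'+]) by [].
apply/cauchy_cvgP/cauchy_exP => e e0.
have ep : 0 < (e / 2) `^ p by rewrite powR_gt0 // divr_gt0.
have [d [d0 td hd]] := control_small_right t0 tT ep.
have td2 : t < t + d / 2 by lra.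
exists (X (t + d / 2)).
suff : \forall a \near t^'+, ball (X (t + d / 2)) e (X a) by [].
near=> a.
have ta : a < t + d / 2 by near: a; apply: nbhs_right_lt.
have at_ : t < a by near: a; apply: nbhs_right_gt.
rewrite /= -ball_normE /= (le_lt_trans (_ : _ <= e / 2)) //; last by lra.
have := powR_le_inv (normr_ge0 (X (t + d / 2) - X a)) (ltW ep).
rewrite -powRrM divff ?gt_eqF // powRr1; last by rewrite ltW // divr_gt0.
apply; apply: (le_trans (Xw _ _ _)) => //; try lra.
by apply: hd => //; lra.
Unshelve. all: by end_near. Qed.

(** Let c increase to t in |X t - X c|^p <= w t - w c <= w t - w a. Taking p-th roots first leaves
    only the norm to pass to the limit. *)
Lemma lft_le a t : 0 <= a -> a < t -> t <= T ->
  `|X t - lft X t| `^ p <= w t - w a.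
Proof.
move=> a0 at_ tT; have t0 := le_lt_trans a0 at_.
have wat : 0 <= w t - w a by rewrite subr_ge0 control_le // ltW.
apply: powR_inv_le => //.
have Xc : `|X t - X c| @[c --> t^'-] --> `|X t - lft X t|.
  by apply: cvg_norm; apply: cvgB; [exact: cvg_cst | exact: lft_cvg].
apply: (cvgr_to_le Xc); near=> c.
have ac : a < c by near: c; apply: nbhs_left_gt.
have ct : c < t by near: c; apply: nbhs_left_lt.
apply: powR_le_inv => //; apply: (le_trans (Xw _ ct tT)).
  by rewrite (le_trans a0) // ltW.
by rewrite lerB // control_le // ltW // (lt_le_trans ct).
Unshelve. all: by end_near. Qed.

Lemma rgt_le t b : 0 <= t -> t < b -> b <= T ->
  `|rgt X t - X t| `^ p <= w b - w t.
Proof.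
move=> t0 tb bT; have tT := lt_le_trans tb bT.
have wtb : 0 <= w b - w t by rewrite subr_ge0 control_le // ltW.
apply: powR_inv_le => //.
have Xc : `|X c - X t| @[c --> t^'+] --> `|rgt X t - X t|.
  by apply: cvg_norm; apply: cvgB; [exact: rgt_cvg | exact: cvg_cst].
apply: (cvgr_to_le Xc); near=> c.
have cb : c < b by near: c; apply: nbhs_right_lt.
have tc : t < c by near: c; apply: nbhs_right_gt.
have cT : c <= T by rewrite ltW // (lt_le_trans cb).
apply: powR_le_inv => //; apply: (le_trans (Xw t0 tc cT)).
by rewrite lerD2r control_le // ltW // (le_lt_trans t0).
Unshelve. all: by end_near. Qed.
End controlled_path.

(** * Convergence of the sums of remainders to the sums of jumps *)

Section remainder_sums.
Variables (R : realType) (V U : completeNormedModType R) (n : nat).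
Variables (p T C : R) (X : R -> V) (w : R -> R) (r : V -> V -> U).
Implicit Types a b c d e t : R.
Hypothesis p0 : 0 < p.
Hypothesis pn : p < n.+1%:R.
Hypothesis T0 : 0 < T.
Hypothesis C0 : 0 <= C.
Hypothesis Xw : forall a b, 0 <= a -> a < b -> b <= T ->
  `|X b - X a| `^ p <= w b - w a.
Hypothesis r_le : forall x y, `|r x y| <= C * `|y - x| ^+ n.+1.
Hypothesis r_cvg : forall (G : set_system R), Filter G ->
  forall (f g : R -> V) (x y : V), f @ G --> x -> g @ G --> y ->
  r (f t) (g t) @[t --> G] --> r x y.

(** The gain over linear growth: |y - x|^(n+1) is (|y - x|^p)^k |y - x|^p, with k > 0 because p < n
    + 1. *)
Let k := (n.+1%:R - p) / p.

Let k0 : 0 < k.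
Proof. by rewrite divr_gt0 // subr_gt0. Qed.

Lemma r_le_powR x y :
  `|r x y| <= C * (`|y - x| `^ p) `^ k * `|y - x| `^ p.
Proof.
rewrite (le_trans (r_le x y)) // -mulrA ler_wpM2l //.
have nE : n.+1%:R = p * k + p by rewrite mulrC divfK ?subrK // gt_eqF.
by rewrite -powR_mulrn // nE powRD -?nE ?pnatr_eq0 // powRrM.
Qed.

Lemma r_small e : 0 < e -> exists2 h, 0 < h &
  forall x y, `|y - x| `^ p <= h -> `|r x y| <= e * `|y - x| `^ p.
Proof.
move=> e0; have C1 : 0 < C + 1 by rewrite ltr_wpDl.
have eC : 0 < e / (C + 1) by rewrite divr_gt0.
(* Up to this threshold, C times the k-th power is at most e. *)
exists ((e / (C + 1)) `^ k^-1); first by rewrite powR_gt0.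
move=> x y xy; rewrite (le_trans (r_le_powR x y)) // ler_wpM2r ?powR_ge0 //.
have /(le_trans _) : C * (e / (C + 1)) <= e.
  by rewrite mulrCA ler_piMr ?(ltW e0) // ler_pdivrMr // mul1r lerDl.
apply; rewrite ler_wpM2l //.
rewrite (le_trans (ge0_ler_powR (ltW k0) _ _ xy)) ?nnegrE ?powR_ge0 //.
by rewrite -powRrM mulVf ?gt_eqF // powRr1 // ltW.
Qed.

Lemma r_linear B : 0 <= B -> exists2 K, 0 <= K &
  forall x y, `|y - x| `^ p <= B -> `|r x y| <= K * `|y - x| `^ p.
Proof.
move=> B0; exists (C * B `^ k); first by rewrite mulr_ge0 // powR_ge0.
move=> x y xy; rewrite (le_trans (r_le_powR x y)) // ler_wpM2r ?powR_ge0 //.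
by rewrite ler_wpM2l // (ge0_ler_powR (ltW k0)) ?nnegrE ?powR_ge0.
Qed.

Let w_le := control_le Xw.

Let wT0 : 0 <= w T - w 0.
Proof. by rewrite subr_ge0 w_le // ltW. Qed.

Let w_sub_le a b : 0 <= a -> a <= b -> b <= T -> w b - w a <= w T - w 0.
Proof.
by move=> a0 ab bT; rewrite lerB // w_le // ?(le_trans ab) // (le_trans a0).
Qed.

(** No increment of w exceeds [w T - w 0], so one constant from [r_linear] serves all jumps. *)
Lemma jumps_linear : exists2 K, 0 <= K & forall a b, 0 <= a -> a < b -> b <= T ->
  `|r (X a) (rgt X a)| <= K * (w b - w a) /\ `|r (lft X b) (X b)| <= K * (w b - w a).
Proof.
have [K K0 hK] := r_linear wT0; exists K => // a b a0 ab bT.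
have wab := w_sub_le a0 (ltW ab) bT.
have ra := rgt_le p0 Xw a0 ab bT; have lb := lft_le p0 Xw a0 ab bT.
by split; rewrite (le_trans (hK _ _ _)) ?ler_wpM2l // (le_trans _ wab).
Qed.

(** Over a partition, the subtracted terms run once through the right jumps at left endpoints and
    once through the left jumps at right endpoints. *)
Definition jump_free a b : U :=
  r (X a) (X b) - r (X a) (rgt X a) - r (lft X b) (X b).

Lemma jump_free_small e : 0 < e -> exists2 h, 0 < h &
  forall a b, 0 <= a -> a < b -> b <= T -> w b - w a <= h ->
    `|jump_free a b| <= e * (w b - w a).
Proof.
move=> e0; have e3 : 0 < e / 3 by rewrite divr_gt0.
have [h h0 hh] := r_small e3; exists h => // a b a0 ab bT wh.
have aux x y : `|y - x| `^ p <= w b - w a -> `|r x y| <= e / 3 * (w b - w a).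
  by move=> xy; rewrite (le_trans (hh _ _ (le_trans xy wh))) // ler_wpM2l // ltW.
have := aux _ _ (Xw a0 ab bT).
have := aux _ _ (rgt_le p0 Xw a0 ab bT).
have := aux _ _ (lft_le p0 Xw a0 ab bT).
have := ler_normB (r (X a) (X b) - r (X a) (rgt X a)) (r (lft X b) (X b)).
have := ler_normB (r (X a) (X b)) (r (X a) (rgt X a)).
rewrite -/(jump_free a b); lra.
Qed.

(* Either [w] is continuous from the right at [t], and intervals starting at [t]
   have small increments, or [w] jumps there, by more than [h], and it is enough
   that [jump_free t b] tends to 0. *)
Lemma jump_free_right t e : 0 <= t -> t < T -> 0 < e ->
  exists2 d, 0 < d & forall a b, t <= a -> a < b -> b < t + d -> b <= T ->
    `|jump_free a b| <= e * (w b - w a).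
Proof.
move=> t0 tT e0; have [h h0 hh] := jump_free_small e0.
have [K K0 hK] := jumps_linear.
have K1 : 0 < K + 1 by rewrite ltr_wpDl.
(* The bound [h] serves intervals that start after t; the other one gives K g <= e h / 2, for the
   left jump at b. *)
pose g := Num.min h (e * h / 2 / (K + 1)).
have eh2 : 0 < e * h / 2 by rewrite divr_gt0 // mulr_gt0.
have g0 : 0 < g by rewrite lt_min h0 divr_gt0.
have [d1 [d10 td1 hd1]] := control_small_right Xw t0 tT g0.
have gt_case d a b : 0 < d -> d <= d1 -> t < a -> a < b -> b < t + d -> b <= T ->
    `|jump_free a b| <= e * (w b - w a).
  move=> d0 dd1 ta ab bd bT; apply: hh => //; first by rewrite ltW // (le_lt_trans t0).
  rewrite (le_trans (_ : _ <= g)) ?ge_min ?lexx //.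
  by rewrite hd1 ?(ltW ab) // (lt_le_trans bd) // lerD2l.
have [[b0 [tb0 b0T wb0]]|nb0] := pselect (exists b, [/\ t < b, b <= T & w b - w t <= h]).
  exists (Num.min d1 (b0 - t)); first by rewrite lt_min d10 subr_gt0.
  move=> a b; rewrite le_eqVlt => /predU1P[<-|ta] ab bd bT; last first.
    apply: gt_case bd bT => //; first by rewrite lt_min d10 subr_gt0.
    by rewrite ge_min lexx.
  apply: hh => //; rewrite (le_trans _ wb0) // lerD2r w_le //; first lra.
  rewrite ltW // (lt_le_trans bd) //.
  by rewrite -lerBrDl ge_min lexx orbT.
have rX : r (X t) (X b) @[b --> t^'+] --> r (X t) (rgt X t).
  apply: (@r_cvg _ _ (fun=> X t) X); first exact: cvg_cst.
  exact: (rgt_cvg p0 Xw).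
have /cvgrPdistC_le/(_ _ eh2) := rX.
rewrite near_withinE => /nbhs_ballP[d2 /= d20 hd2].
exists (Num.min d1 d2); first by rewrite lt_min d10 d20.
move=> a b; rewrite le_eqVlt => /predU1P[<-|ta] tb bd bT; last first.
  apply: gt_case bd bT => //; first by rewrite lt_min d10 d20.
  by rewrite ge_min lexx.
have bd1 : b < t + d1 by rewrite (lt_le_trans bd) // lerD2l ge_min lexx.
have bd2 : b < t + d2 by rewrite (lt_le_trans bd) // lerD2l ge_min lexx orbT.
have wh : h <= w b - w t.
  by rewrite leNgt; apply/negP => /ltW wh; apply: nb0; exists b.
have r1 : `|r (X t) (X b) - r (X t) (rgt X t)| <= e * h / 2.
  apply: hd2 => //; rewrite -ball_normE /= distrC gtr0_norm ?subr_gt0 //; lra.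
(* The left jump at b is measured from some c > t, so that the jump of w at t does not enter. *)
pose c := (t + b) / 2.
have tc : t < c by rewrite /c; lra.
have cb : c < b by rewrite /c; lra.
have r2 : `|r (lft X b) (X b)| <= e * h / 2.
  have [|//|//|_ r2] := hK c b; first lra.
  rewrite (le_trans r2) // (le_trans (_ : _ <= K * g)) ?ler_wpM2l ?hd1 // ?(ltW cb) //.
  rewrite (le_trans (_ : _ <= K * (e * h / 2 / (K + 1)))) //.
    by rewrite ler_wpM2l // ge_min lexx orbT.
  by rewrite mulrCA ler_piMr ?(ltW eh2) // ler_pdivrMr // mul1r lerDl.
rewrite (le_trans (ler_normB _ _)) // (le_trans (lerD r1 r2)) // -splitr.
by rewrite ler_wpM2l // ltW.
Qed.

(** Mirror image: if w jumps at t, then r(X a, X t) tends to the left jump term at t, and the right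
    jump at a is measured on an interval that ends before t. *)
Lemma jump_free_left t e : 0 < t -> t <= T -> 0 < e ->
  exists2 d, 0 < d & forall a b, 0 <= a -> t - d < a -> a < b -> b <= t ->
    `|jump_free a b| <= e * (w b - w a).
Proof.
move=> t0 tT e0; have [h h0 hh] := jump_free_small e0.
have [K K0 hK] := jumps_linear.
have K1 : 0 < K + 1 by rewrite ltr_wpDl.
pose g := Num.min h (e * h / 2 / (K + 1)).
have eh2 : 0 < e * h / 2 by rewrite divr_gt0 // mulr_gt0.
have g0 : 0 < g by rewrite lt_min h0 divr_gt0.
have [d1 [d10 td1 hd1]] := control_small_left Xw t0 tT g0.
have lt_case d a b : d <= d1 -> 0 <= a -> t - d < a -> a < b -> b < t ->
    `|jump_free a b| <= e * (w b - w a).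
  move=> dd1 a0 da ab bt; apply: hh => //; first by rewrite ltW // (lt_le_trans bt).
  rewrite (le_trans (_ : _ <= g)) ?ge_min ?lexx //.
  by rewrite hd1 ?(ltW ab) // (le_lt_trans _ da) // lerB.
have [[a1 [a10 a1t wa1]]|na1] := pselect (exists a, [/\ 0 <= a, a < t & w t - w a <= h]).
  exists (Num.min d1 (t - a1)); first by rewrite lt_min d10 subr_gt0.
  move=> a b a0 da ab; rewrite le_eqVlt => /predU1P[bE|bt]; last first.
    by apply: lt_case da ab bt => //; rewrite ge_min lexx.
  rewrite bE in ab *; apply: hh => //.
  rewrite (le_trans _ wa1) // lerB // w_le //; last by rewrite ltW // (lt_le_trans ab).
  rewrite ltW // (le_lt_trans _ da) // lerBrDl -lerBrDr.
  by rewrite ge_min lexx orbT.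
have rX : r (X a) (X t) @[a --> t^'-] --> r (lft X t) (X t).
  apply: (@r_cvg _ _ X (fun=> X t)); last exact: cvg_cst.
  exact: (lft_cvg p0 Xw).
have /cvgrPdistC_le/(_ _ eh2) := rX.
rewrite near_withinE => /nbhs_ballP[d2 /= d20 hd2].
exists (Num.min d1 d2); first by rewrite lt_min d10 d20.
move=> a b a0 da ab; rewrite le_eqVlt => /predU1P[bE|bt]; last first.
  by apply: lt_case da ab bt => //; rewrite ge_min lexx.
rewrite bE in ab *.
have ad1 : t - d1 < a by rewrite (le_lt_trans _ da) // lerB // ge_min lexx.
have ad2 : t - d2 < a by rewrite (le_lt_trans _ da) // lerB // ge_min lexx orbT.
have wh : h <= w t - w a.
  by rewrite leNgt; apply/negP => /ltW wh; apply: na1; exists a.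
have r1 : `|r (X a) (X t) - r (lft X t) (X t)| <= e * h / 2.
  apply: hd2 => //; rewrite -ball_normE /= gtr0_norm ?subr_gt0 //; lra.
pose c := (a + t) / 2.
have ac : a < c by rewrite /c; lra.
have ct : c < t by rewrite /c; lra.
have r2 : `|r (X a) (rgt X a)| <= e * h / 2.
  have [//|//||r2 _] := hK a c; first lra.
  rewrite (le_trans r2) // (le_trans (_ : _ <= K * g)) ?ler_wpM2l ?hd1 // ?(ltW ac) //.
  rewrite (le_trans (_ : _ <= K * (e * h / 2 / (K + 1)))) //.
    by rewrite ler_wpM2l // ge_min lexx orbT.
  by rewrite mulrCA ler_piMr ?(ltW eh2) // ler_pdivrMr // mul1r lerDl.
rewrite /jump_free addrAC (le_trans (ler_normB _ _)) // (le_trans (lerD r1 r2)) //.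
by rewrite -splitr ler_wpM2l // ltW.
Qed.

(** The property passed from local to global is that finitely many exceptional points suffice on
    [c, d]. A partition through them has none inside its intervals, so the bounds telescope. *)
Lemma jump_free_sum_small e : 0 < e -> exists l : seq R,
  forall s, is_partition T s -> (forall t, t \in l -> 0 < t <= T -> t \in s) ->
    `|psum s jump_free| <= e * (w T - w 0).
Proof.
move=> e0.
pose Q c d := exists l : seq R, forall a b, c <= a -> a < b -> b <= d ->
  (forall u, u \in l -> ~~ (a < u < b)) -> `|jump_free a b| <= e * (w b - w a).
have [] : Q 0 T.
  apply: local_to_global => //.
  - move=> x y z x0 xy yz zT [l1 hl1] [l2 hl2].
    (* The junction y joins the list, so that an interval with no listed point inside lies on one
       side of y. *)
    exists (y :: l1 ++ l2) => a b xa ab bz hu.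
    have [yb|by_] := ltP y b.
      have ya : y <= a.
        by rewrite leNgt; apply/negP => ay; have := hu y (mem_head _ _); rewrite ay yb.
      by apply: hl2 => // u ul; apply: hu; rewrite inE mem_cat ul !orbT.
    by apply: hl1 => // u ul; apply: hu; rewrite inE mem_cat ul orbT.
  - move=> t /andP[t0 tT]; have [d d0 hd] := jump_free_right t0 tT e0.
    exists d => // y /andP[ty yd] yT; exists [::] => a b ta ab by_ _.
    by apply: hd => //; [exact: le_lt_trans yd | exact: le_trans yT].
  - move=> t /andP[t0 tT]; have [d d0 hd] := jump_free_left t0 tT e0.
    exists d => // x /andP[dx xt] x0; exists [::] => a b xa ab bt _.
    by apply: hd => //; [exact: le_trans xa | exact: lt_le_trans xa].
move=> l hl; exists l => s sT ls.
have [ps /eqP lastT] := andP sT.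
rewrite mulrBr -lastT.
apply: (psum_norm_le (w := fun t => e * w t)) => // a b sa sb ab nu.
have /andP[a0 aT] := partition_mem sT sa; have /andP[b0 bT] := partition_mem sT sb.
rewrite -mulrBr; apply: hl => // u ul; apply/negP => uab.
have us : u \in s.
  apply: ls => //; have /andP[au ub] := uab.
  by rewrite (le_lt_trans a0 au) (le_trans (ltW ub)).
by have := nu u us; rewrite uab.
Qed.

(** Complete a finite set of times to a partition and charge the left jump at b to the interval
    ending there; the charges K (w b - w a) telescope. *)
Lemma left_jumps_abs_sum :
  exists S : U, abs_sum [set t | 0 < t <= T] (fun t => r (lft X t) (X t)) S.
Proof.
have [K K0 hK] := jumps_linear.
apply: (@abs_sum_exists _ _ _ _ (K * (w T - w 0))) => s us sA.
have [q qT sq] := partition_through s T0.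
have [ps /eqP lastT] := andP qT.
have uq : uniq q by have := partition_uniq qT; rewrite cons_uniq => /andP[].
have {}sq : {subset s <= q} by move=> t ts; apply: sq => //; have := sA t ts; rewrite inE.
rewrite (le_trans (_ : _ <= \sum_(t <- q) `|r (lft X t) (X t)|)) //.
  by rewrite (big_uniq_subset _ us uq sq) lerDl sumr_ge0.
rewrite -psum_snd -[leLHS]ger0_norm ?psum_snd ?sumr_ge0 // -psum_snd mulrBr -lastT.
apply: (psum_norm_le (w := fun t => K * w t)) => // a b sa sb ab _.
have /andP[a0 aT] := partition_mem qT sa; have /andP[b0 bT] := partition_mem qT sb.
by rewrite normr_id -mulrBr; have [] := hK a b a0 ab bT.
Qed.

(** Now a jump at a is charged to the interval that starts there; the left endpoints are
    [belast 0 q], with 0 and without T. *)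
Lemma right_jumps_abs_sum :
  exists S : U, abs_sum [set t | 0 <= t < T] (fun t => r (X t) (rgt X t)) S.
Proof.
have [K K0 hK] := jumps_linear.
apply: (@abs_sum_exists _ _ _ _ (K * (w T - w 0))) => s us sA.
have [q qT sq] := partition_through s T0.
have [ps /eqP lastT] := andP qT.
have uq : uniq (belast 0 q).
  by have := partition_uniq qT; rewrite lastI rcons_uniq => /andP[].
have {}sq : {subset s <= belast 0 q}.
  move=> t ts; have := sA t ts; rewrite inE /= => /andP[t0 tT].
  rewrite (partition_belast _ qT) tT andbT inE.
  by move: t0; rewrite le_eqVlt eq_sym => /orP[->//|t0]; rewrite sq ?orbT // t0 ltW.
rewrite (le_trans (_ : _ <= \sum_(t <- belast 0 q) `|r (X t) (rgt X t)|)) //.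
  by rewrite (big_uniq_subset _ us uq sq) lerDl sumr_ge0.
rewrite -psum_fst -[leLHS]ger0_norm ?psum_fst ?sumr_ge0 // -psum_fst mulrBr -lastT.
apply: (psum_norm_le (w := fun t => K * w t)) => // a b sa sb ab _.
have /andP[a0 aT] := partition_mem qT sa; have /andP[b0 bT] := partition_mem qT sb.
by rewrite normr_id -mulrBr; have [] := hK a b a0 ab bT.
Qed.

(** The partition [q] contains the exceptional points and, up to the endpoint 0, the finite sets
    that nearly exhaust both jump sums. Three errors remain, each below e/3: left jumps, right jumps
    and [jump_free]. *)
Lemma remainder_sum_cvg Sm Sp :
  abs_sum [set t | 0 < t <= T] (fun t => r (lft X t) (X t)) Sm ->
  abs_sum [set t | 0 <= t < T] (fun t => r (X t) (rgt X t)) Sp ->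
  RRS_cvg T (fun s => psum s (fun a b => r (X a) (X b))) (Sm + Sp).
Proof.
move=> [_ _ hSm] [_ _ hSp] e e0.
have e3 : 0 < e / 3 by rewrite divr_gt0.
have W1 : 0 < w T - w 0 + 1 by rewrite ltr_wpDl.
(* Scaled to stay below e/3 after multiplication by [w T - w 0], which may vanish. *)
have e4 : 0 < e / 3 / (w T - w 0 + 1) by rewrite divr_gt0.
have [sm [_ [smA hm]]] := hSm _ e3.
have [sp [_ [spA hp]]] := hSp _ e3.
have [l hl] := jump_free_sum_small e4.
have [q qT hq] := partition_through (sm ++ sp ++ l) T0.
exists q; split => // s sT qs.
have [ps /eqP lastT] := andP sT.
have us := partition_uniq sT.
have pos t : t \in s -> 0 < t <= T.
  move=> ts; have /andP[t0 ->] : 0 <= t <= T.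
    by apply: (partition_mem sT); rewrite inE ts orbT.
  rewrite andbT lt_neqAle t0 andbT; apply/eqP => t0E.
  by move: us; rewrite /= t0E ts.
have mem t : t \in sm ++ sp ++ l -> 0 < t <= T -> t \in s.
  by move=> tl tT; apply: qs; exact: hq.
have Em : `|psum s (fun _ b => r (lft X b) (X b)) - Sm| < e / 3.
  rewrite psum_snd; apply: hm => [|t|t tm]; first by case/andP: us.
    by move=> /pos; rewrite inE.
  by apply: mem; [rewrite mem_cat tm | have := smA t tm; rewrite inE].
have Ep : `|psum s (fun a _ => r (X a) (rgt X a)) - Sp| < e / 3.
  rewrite psum_fst; apply: hp => [|t|t tp].
  - by move: us; rewrite lastI rcons_uniq => /andP[].
  - rewrite (partition_belast _ sT) => /andP[/(partition_mem sT)/andP[t0 _] tT].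
    by rewrite inE /= t0 tT.
  - have := spA t tp; rewrite inE /= => /andP[t0 tT].
    rewrite (partition_belast _ sT) tT andbT inE.
    move: t0; rewrite le_eqVlt eq_sym => /orP[->//|t0].
    by rewrite mem ?orbT // ?t0 ?ltW // !mem_cat tp orbT.
have Ef : `|psum s jump_free| < e / 3.
  rewrite (le_lt_trans (hl s sT _)) // => [t tl|].
    by apply: mem; rewrite !mem_cat tl !orbT.
  by rewrite mulrAC -mulrA gtr_pMr // ltr_pdivrMr // mul1r ltrDl.
have sumE : psum s (fun a b => r (X a) (X b)) = psum s jump_free +
    psum s (fun _ b => r (lft X b) (X b)) + psum s (fun a _ => r (X a) (rgt X a)).
  rewrite /psum -!big_split; apply: eq_bigr => -[a b] _ /=.
  by rewrite /jump_free !subrK.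
have -> : psum s (fun a b => r (X a) (X b)) - (Sm + Sp) = psum s jump_free +
    (psum s (fun _ b => r (lft X b) (X b)) - Sm) +
    (psum s (fun a _ => r (X a) (rgt X a)) - Sp).
  by rewrite sumE opprD [LHS]addrACA -(addrA (psum s jump_free)).
have := ler_normD (psum s jump_free + (psum s (fun _ b => r (lft X b) (X b)) - Sm))
  (psum s (fun a _ => r (X a) (rgt X a)) - Sp).
have := ler_normD (psum s jump_free) (psum s (fun _ b => r (lft X b) (X b)) - Sm).
lra.
Qed.
End remainder_sums.

(** * The change of variables formula *)

Theorem theorem3p2 (R : realType) (V U : completeNormedModType R)
  (p T : R) (X : R -> V) (F : V -> U)
  (D : forall k : nat, V -> {ffun 'I_k -> V} -> U) :
  1 <= p -> 0 < T ->
  finite_pvar p T X ->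
  Cb (Num.truncn p).+1 F D ->
  let n := Num.truncn p in
  exists I : U,
    RRS_cvg T (fun s => psum s (fun a b => taylor D n (X a) (X b - X a))) I /\
    (exists Sm Sp : U,
       abs_sum [set t | 0 < t <= T]
         (fun t => F (X t) - F (lft X t) - taylor D n (lft X t) (X t - lft X t)) Sm /\
       abs_sum [set t | 0 <= t < T]
         (fun t => F (rgt X t) - F (X t) - taylor D n (X t) (rgt X t - X t)) Sp /\
       F (X T) - F (X 0) = I + Sm + Sp) /\
    ((forall t, 0 <= t < T -> X x @[x --> t^'+] --> X t) ->
     (forall t, 0 < t <= T -> cvg (X x @[x --> t^'-])) ->
     exists Sm : U,
       abs_sum [set t | 0 < t <= T]
         (fun t => F (X t) - F (lft X t) - taylor D n (lft X t) (X t - lft X t)) Sm /\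
       F (X T) - F (X 0) = I + Sm) /\
    ({within `[0, T], continuous X} -> F (X T) - F (X 0) = I).
Proof.
move=> p1 T0 Xp CbF n.
have p0 : 0 < p by rewrite (lt_le_trans ltr01).
have pn : p < n.+1%:R by have /andP[] := truncn_itv (ltW p0).
have [w Xw] := pvar_control T0 Xp.
have [C C0 r_le] := remainder_bound CbF.
pose r := remainder n F D.
have r_cvg (G : set_system R) : Filter G -> forall (f g : R -> V) (x y : V),
    f @ G --> x -> g @ G --> y -> r (f t) (g t) @[t --> G] --> r x y.
  by move=> FG f g x y; exact: remainder_cvg.
have [Sm hSm] : exists S, abs_sum [set t | 0 < t <= T] (fun t => r (lft X t) (X t)) S.
  exact: left_jumps_abs_sum p0 pn T0 C0 Xw r_le.
have [Sp hSp] : exists S, abs_sum [set t | 0 <= t < T] (fun t => r (X t) (rgt X t)) S.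
  exact: right_jumps_abs_sum p0 pn T0 C0 Xw r_le.
have rS := remainder_sum_cvg p0 pn T0 C0 Xw r_le r_cvg hSm hSp.
(* Hence a jump term vanishes where the one-sided limit equals the value of X. *)
have r0 x : r x x = 0.
  apply/eqP; rewrite -normr_le0 (le_trans (r_le x x)) // subrr normr0.
  by rewrite expr0n mulr0.
have IE : F (X T) - F (X 0) = F (X T) - F (X 0) - (Sm + Sp) + Sm + Sp.
  by rewrite -[RHS]addrA subrK.
(* The integral is taken to be what the formula demands; it remains to see that the Taylor sums
   converge to it. *)
exists (F (X T) - F (X 0) - (Sm + Sp)); split; [|split; [|split]].
- move=> e e0; have [q [qT hq]] := rS e e0; exists q; split => // s sT qs.
  (* Taylor terms and remainders add up to the increments of F along X, which telescope. *)
  have -> : psum s (fun a b => taylor D n (X a) (X b - X a)) =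
      F (X T) - F (X 0) - psum s (fun a b => r (X a) (X b)).
    have /andP[_ /eqP lastT] := sT.
    rewrite -{1}lastT -(psum_telescope s (F \o X)) /psum -sumrB.
    by apply: eq_bigr => -[a b] _; rewrite /r /remainder /= subKr.
  rewrite opprB addrC addrA subrK distrC; exact: hq.
- by exists Sm, Sp.
- move=> Xr _; exists Sm; split => //; rewrite {1}IE.
  have -> : Sp = 0.
    apply: (abs_sum_const0 hSp) => t /Xr Xt.
    by rewrite /rgt (cvg_lim _ Xt).
  by rewrite !addr0.
(* Continuity within [0, T] is two-sided inside and one-sided at 0 and T, which suffices for both
   families of jumps. *)
- move=> /(continuous_within_itvP _ T0)[Xc X0 XT]; rewrite {1}IE.
  have -> : Sp = 0.
    apply: (abs_sum_const0 hSp) => t /= /andP[t0 tT].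
    have Xt : X x @[x --> t^'+] --> X t.
      move: t0; rewrite le_eqVlt => /predU1P[<-//|t0].
      by apply: cvg_at_right_filter; apply: Xc; rewrite in_itv /= t0.
    by rewrite /rgt (cvg_lim _ Xt).
  have -> : Sm = 0.
    apply: (abs_sum_const0 hSm) => t /= /andP[t0 tT].
    have Xt : X x @[x --> t^'-] --> X t.
      move: tT; rewrite le_eqVlt => /predU1P[->//|tT].
      by apply: cvg_at_left_filter; apply: Xc; rewrite in_itv /= t0.
    by rewrite /lft (cvg_lim _ Xt).
  by rewrite !addr0.
Qed.
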